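(* Let $p$ be a prime and let $a,b,c\in\mathbb{C}_p$ satisfy $b\neq 0$, $c\neq ab$ and $(c-1)^2+4ab\neq 0$. Let $f(x)=\frac{x+a}{bx+c}$ for $x\in\mathbb{C}_p\setminus\{\hat x\}$ with $\hat x=-\frac{c}{b}$, and let $x_1,x_2$ be its two fixed points. For $i=1,2$ put $\alpha_i=\left|\frac{1-bx_i}{b}\right|_p$ and $\beta_i=\left|\frac{bx_i+c}{b}\right|_p$. If $x\in\mathbb{C}_p\setminus(\mathcal{P}_p\cup\{x_2\})$ (resp. $x\in\mathbb{C}_p\setminus(\mathcal{P}_p\cup\{x_1\})$), then the $p$-adic dynamical system generated by $f$ has the following properties: 1. $\lim_{n\to\infty}f^n(x)=x_1$ if $\alpha_1<\beta_1$ (resp. $\lim_{n\to\infty}f^n(x)=x_2$ if $\alpha_2<\beta_2$). 2. $\lim_{n\to\infty}f^n(x)\in S_{\alpha_i}(x_i)$ if $\alpha_i>\beta_i$, where $i=1$ (resp. $i=2$).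
   Context: $\mathbb{C}_p$ is the field of complex $p$-adic numbers (the completion of an algebraic closure of $\mathbb{Q}_p$) with norm $|\cdot|_p$ extending the $p$-adic norm. For $y\in\mathbb{C}_p$ and $r>0$: $S_r(y)=\{x\in\mathbb{C}_p:|x-y|_p=r\}$. $f^n$ denotes the $n$-fold iterate of $f$ (with $f^0(x)=x$), and $\mathcal{P}_p=\{x\in\mathbb{C}_p:\ \exists n\in\mathbb{N}\cup\{0\},\ f^n(x)=\hat x\}$. The fixed points are $x_1=\frac{1-c+\sqrt{D}}{2b}$ and $x_2=\frac{1-c-\sqrt{D}}{2b}$, where $D=(c-1)^2+4ab$ and $\sqrt{D}$ is a fixed square root of $D$ in $\mathbb{C}_p$. ''Resp.'' means that the hypothesis excluding $x_2$ goes with index 1 and the hypothesis excluding $x_1$ goes with index 2.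
   Formalization: In item 2 the starting point x is additionally required to differ from x_i, since for x = x_i the orbit is constant with limit x_i, which does not lie on S_{α_i}(x_i) when α_i > β_i (e.g. a=0, b=1, c=p, x=x_1=0). *)

(* Defs.v *)
(* MathComp + MathComp-Analysis; the absolute values take their values in an
   arbitrary [R : realType]. *)
From HB Require Import structures.
From mathcomp Require Import all_boot all_order all_algebra.
From mathcomp Require Import boolp classical_sets reals topology normedtype.
From mathcomp Require Import sequences.

Set Implicit Arguments.
Unset Strict Implicit.
Unset Printing Implicit Defensive.

Import Order.TTheory GRing.Theory Num.Theory.
Import numFieldNormedType.Exports.

Local Open Scope classical_set_scope.
Local Open Scope ring_scope.

Record na_absval (R : realType) (K : fieldType) (v : K -> R) : Prop := {
  absval_ge0 : forall x, 0 <= v x;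
  absval_eq0 : forall x, v x = 0 <-> x = 0;
  absvalM : forall x y, v (x * y) = v x * v y;
  absvalD : forall x y, v (x + y) <= Num.max (v x) (v y) }.

Definition absval_cvg (R : realType) (K : fieldType) (v : K -> R)
    (u : nat -> K) (l : K) : Prop :=
  (fun n => v (u n - l)) @ \oo --> (0 : R).

Definition absval_complete (R : realType) (K : fieldType) (v : K -> R) : Prop :=
  forall u : nat -> K,
    (forall e : R, 0 < e -> exists N : nat, forall m n : nat,
       (N <= m)%N -> (N <= n)%N -> v (u m - u n) < e) ->
    exists l : K, absval_cvg v u l.

Record is_completion (R : realType) (K L : fieldType) (v : K -> R) (w : L -> R)
    (iota : {rmorphism K -> L}) : Prop := {
  completion_absval : na_absval w;
  completion_isometry : forall x, w (iota x) = v x;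
  completion_dense : forall (y : L) (e : R), 0 < e ->
    exists x : K, w (y - iota x) < e;
  completion_complete : absval_complete w }.

(* For x != 0 this is p ^ (- ord_p x). *)
Definition padic_absval (R : realType) (p : nat) (x : rat) : R :=
  if x == 0 then 0
  else (p%:R : R) ^ ((logn p `|denq x|%N)%:Z - (logn p `|numq x|%N)%:Z).

(* The rationals, their p-adic completion Q_p, an algebraic closure of Q_p with
   an absolute value extending that of Q_p, and the completion of the latter.
   These data determine [Cp], with its absolute value, up to isometric
   isomorphism. *)
Record complex_padic (R : realType) (p : nat) := ComplexPadic {
  Qp : fieldType;
  Qp_absval : Qp -> R;
  rat_to_Qp : {rmorphism rat -> Qp};
  Qp_completion : is_completion (padic_absval R p) Qp_absval rat_to_Qp;
  Qpbar : closedFieldType;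
  Qpbar_absval : Qpbar -> R;
  Qp_to_Qpbar : {rmorphism Qp -> Qpbar};
  Qpbar_algebraic : forall x : Qpbar, algebraicOver Qp_to_Qpbar x;
  Qpbar_na_absval : na_absval Qpbar_absval;
  Qpbar_extends : forall x : Qp, Qpbar_absval (Qp_to_Qpbar x) = Qp_absval x;
  Cp :> fieldType;
  Cp_absval : Cp -> R;
  Qpbar_to_Cp : {rmorphism Qpbar -> Cp};
  Cp_completion : is_completion Qpbar_absval Cp_absval Qpbar_to_Cp }.

Arguments Cp_absval {R p} c _.

Section MobiusSystem.
Variables (R : realType) (p : nat) (C : complex_padic R p).

Definition padic_sphere (r : R) (y : C) : set C :=
  [set x | Cp_absval C (x - y) = r].

Definition pole (b c : C) : C := - (c / b).

(* A total function: its value at [pole b c] is the junk value 0. *)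
Definition mobius (a b c x : C) : C := (x + a) / (b * x + c).

(* The junk value of [mobius] plays no role here: an orbit can only use it after
   having visited [pole b c]. *)
Definition pole_orbit (a b c : C) : set C :=
  [set x | exists n : nat, iter n (mobius a b c) x = pole b c].

Definition discr (a b c : C) : C := (c - 1) ^+ 2 + 4%:R * a * b.

(* [s] is a square root of [discr a b c]. *)
Definition fixpt1 (b c s : C) : C := (1 - c + s) / (2%:R * b).
Definition fixpt2 (b c s : C) : C := (1 - c - s) / (2%:R * b).

Definition alpha (b y : C) : R := Cp_absval C ((1 - b * y) / b).
Definition beta (b c y : C) : R := Cp_absval C ((b * y + c) / b).

End MobiusSystem.

(* Main.v *)
(* With q_i = b x_i + c one has f(x) - x_1 = q_2 (x - x_1) / (b x + c) and
   f(x) - x_2 = q_1 (x - x_2) / (b x + c), so f multiplies the cross-ratio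
   (x - x_1) / (x - x_2) by q_2 / q_1.  Moreover alpha_1 = beta_2 = |q_2 / b| and
   beta_1 = alpha_2 = |q_1 / b|.  Hence the orbit of every point outside the
   other fixed point tends to the fixed point x_i with the larger |q_i|; when
   alpha_i > beta_i that is the other fixed point, which lies at distance
   |q_1 - q_2| / |b| = alpha_i from x_i. *)
Require Import Defs.
From HB Require Import structures.
From mathcomp Require Import all_boot all_order all_algebra.
From mathcomp Require Import boolp classical_sets reals topology normedtype.
From mathcomp Require Import sequences.
From mathcomp Require Import ring.

Set Implicit Arguments.
Unset Strict Implicit.
Unset Printing Implicit Defensive.

Import Order.TTheory GRing.Theory Num.Theory.
Import numFieldNormedType.Exports.

Local Open Scope classical_set_scope.
Local Open Scope ring_scope.

Section NonArchimedean.
Variables (R : realType) (K : fieldType) (v : K -> R).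
Hypothesis v_abs : na_absval v.

Lemma absval_neq0 x : x != 0 -> v x != 0.
Proof. by move/eqP=> x0; apply/eqP => /(absval_eq0 v_abs). Qed.

Lemma absval_gt0 x : x != 0 -> 0 < v x.
Proof. by move=> x0; rewrite lt_def absval_neq0 // absval_ge0. Qed.

Lemma absval1 : v 1 = 1.
Proof.
by apply: (mulfI (absval_neq0 (oner_neq0 K))); rewrite -absvalM // !mulr1.
Qed.

Lemma absvalX x n : v (x ^+ n) = v x ^+ n.
Proof.
by elim: n => [|n IH]; rewrite ?expr0 ?absval1 // !exprS absvalM // IH.
Qed.

Lemma absvalN x : v (- x) = v x.
Proof.
have vN1 : v (-1) = 1.
  apply/eqP; rewrite -(@pexpr_eq1 _ _ 2) ?absval_ge0 //.
  by rewrite -absvalX sqrrN expr1n absval1.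
by rewrite -mulN1r absvalM // vN1 mul1r.
Qed.

(** Isosceles principle: if [x - y] were smaller than [x], then [x = (x - y) + y] would be a sum of
    two smaller terms. *)
Lemma absval_subl x y : v y < v x -> v (x - y) = v x.
Proof.
move=> yx; apply/eqP; rewrite eq_le; apply/andP; split.
  by apply: le_trans (absvalD v_abs _ _) _; rewrite absvalN ge_max lexx ltW.
have := absvalD v_abs (x - y) y; rewrite subrK le_max => /orP[//|].
by rewrite leNgt yx.
Qed.

(** The first two hypotheses are Vieta's formulas for the fixed-point equation
    [b t^2 + (c - 1) t - a = 0]. They are symmetric in [y] and [z], so either fixed point can play
    the attracting one. *)
Lemma mobius_orbit_cvg (a b c y z x : K) :
  b * (y + z) = 1 - c -> b * (y * z) = - a ->
  v (b * z + c) < v (b * y + c) -> x != z ->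
  (forall n, b * iter n (fun t => (t + a) / (b * t + c)) x + c != 0) ->
  absval_cvg v (fun n => iter n (fun t => (t + a) / (b * t + c)) x) y.
Proof.
move=> sumyz prodyz lt_q xz nopole; set f := fun t => _ in nopole *.
set q1 := b * y + c in lt_q *; set q2 := b * z + c in lt_q *.
have q1_gt0 : 0 < v q1 by apply: le_lt_trans lt_q; apply: absval_ge0.
have t0_gt0 : 0 < v (x - z) by rewrite absval_gt0 // subr_eq0.
have fy t : b * t + c != 0 -> (f t - y) * (b * t + c) = q2 * (t - y).
  move=> t0; rewrite mulrBl divfK // /q2.
  have -> : a = - (b * (y * z)) by rewrite prodyz opprK.
  by have -> : c = 1 - b * (y + z) by [rewrite sumyz; ring]; ring.
have fz t : b * t + c != 0 -> (f t - z) * (b * t + c) = q1 * (t - z).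
  move=> t0; rewrite mulrBl divfK // /q1.
  have -> : a = - (b * (y * z)) by rewrite prodyz opprK.
  by have -> : c = 1 - b * (y + z) by [rewrite sumyz; ring]; ring.
(* The cross-ratio after [n] steps, cross-multiplied so that no iterate has to be shown distinct
   from [z]. *)
have cross n : (iter n f x - y) * (q1 ^+ n * (x - z)) =
               q2 ^+ n * (x - y) * (iter n f x - z).
  elim: n => [|n IH]; first by rewrite /= !expr0; ring.
  rewrite iterS; apply: (mulIf (nopole n)); move: (iter n f x) (nopole n) IH.
  move=> t t0 IH; rewrite mulrAC fy // -[RHS]mulrA fz // !exprS.
  transitivity (q1 * q2 * ((t - y) * (q1 ^+ n * (x - z)))); first by ring.
  by rewrite IH; ring.
set r := v q2 / v q1; set k := v (x - y) / v (x - z).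
have r_ge0 : 0 <= r by rewrite divr_ge0 ?absval_ge0.
have r_lt1 : `|r| < 1 by rewrite ger0_norm // ltr_pdivrMr // mul1r.
have k_ge0 : 0 <= k by rewrite divr_ge0 ?absval_ge0.
have crossv n : v (iter n f x - y) = r ^+ n * k * v (iter n f x - z).
  have q1n0 := lt0r_neq0 (exprn_gt0 n q1_gt0); have t00 := lt0r_neq0 t0_gt0.
  have := congr1 v (cross n).
  rewrite !(absvalM v_abs) !absvalX /r /k expr_div_n.
  move: (v (iter n f x - y)) (v (iter n f x - z)) => u t.
  move: (v q2 ^+ n) (v q1 ^+ n) q1n0 => q2n q1n q1n0.
  move: (v (x - y)) (v (x - z)) t00 => u0 t0 t00 E.
  by apply: (mulIf (mulf_neq0 q1n0 t00)); rewrite E; field; rewrite q1n0 t00.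
have cvg_rk (m : R) : (fun n => r ^+ n * m) @ \oo --> (0 : R).
  by rewrite -(mul0r m); apply: cvgMr_tmp; exact: cvg_expr.
(* By [crossv] it is enough to bound [v (iter n f x - z)], which is at most the larger of
   [v (iter n f x - y)] and [v (y - z)]. *)
have bound : \forall n \near \oo,
    0 <= v (iter n f x - y) <= r ^+ n * (k * v (y - z)).
  have near_lt1 : \forall n \near \oo, r ^+ n * k < 1.
    by apply: (cvgr_lt (0 : R)) => //; apply: cvg_rk.
  near=> n; rewrite absval_ge0 //=.
  have lt1 : r ^+ n * k < 1 by near: n.
  have rk_ge0 : 0 <= r ^+ n * k by rewrite mulr_ge0 ?exprn_ge0.
  have := absvalD v_abs (iter n f x - y) (y - z).
  rewrite subrKA le_max mulrA => /orP[le_u|le_d]; last first.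
    by rewrite crossv ler_wpM2l.
  (* Here [crossv] gives [u <= r ^+ n * k * u] for [u = v (iter n f x - y)]; as the factor is below
     1, [u] vanishes. *)
  have := ler_wpM2l rk_ge0 le_u; rewrite -crossv -subr_le0 -{1}[v _]mul1r -mulrBl.
  rewrite pmulr_rle0 ?subr_gt0 // => u_le0.
  by apply: le_trans u_le0 _; rewrite mulr_ge0 // absval_ge0.
apply: (squeeze_cvgr bound _ (cvg_rk _)); exact: cvg_cst.
Unshelve. all: by end_near. Qed.

End NonArchimedean.

Section ComplexPadic.
Variables (R : realType) (p : nat) (C : complex_padic R p).

(** Characteristic zero passes from [rat] along the three field embeddings, also when [p] is 2. *)
Lemma Cp_two_neq0 : (2%:R : C) != 0.
Proof.
rewrite -(rmorph_nat (Qpbar_to_Cp C)) -(rmorph_nat (Qp_to_Qpbar C)).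
by rewrite -(rmorph_nat (rat_to_Qp C)) !fmorph_eq0.
Qed.

Lemma mobius_dynamics (a b c y z x : C) :
  b != 0 -> b * (y + z) = 1 - c -> b * (y * z) = - a ->
  ~ (pole_orbit a b c `|` [set z]) x ->
  let orbit_cvg :=
    absval_cvg (Cp_absval C) (fun n => iter n (mobius a b c) x) in
  (alpha b y < beta b c y -> orbit_cvg y) /\
  (beta b c y < alpha b y -> x <> y ->
     exists l : C, orbit_cvg l /\ padic_sphere (alpha b y) y l).
Proof.
move=> b0 sumyz prodyz nx orbit_cvg.
have v_abs := completion_absval (Cp_completion C).
have xz : x != z by apply/eqP => xz; apply: nx; right.
have nopole n : b * iter n (mobius a b c) x + c != 0.
  apply/eqP => E; apply: nx; left; exists n; rewrite /pole.
  by apply: (mulfI b0); rewrite mulrN mulrCA divff // mulr1;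
     apply/eqP; rewrite -addr_eq0 E.
(* Thus [alpha] at [y] is [beta] at [z], and the hypotheses on [alpha] and [beta] compare
   [b * z + c] with [b * y + c]. *)
have q2E : 1 - b * y = b * z + c.
  by have -> : c = 1 - b * (y + z) by [rewrite sumyz; ring]; ring.
have vdiv t : Cp_absval C (t / b) = Cp_absval C t * Cp_absval C b^-1.
  exact: absvalM.
have vb : 0 < Cp_absval C b^-1 by rewrite absval_gt0 // invr_eq0.
rewrite /orbit_cvg /alpha /beta q2E !vdiv !ltr_pM2r //; split=> [lt_q|lt_q xy].
  exact: mobius_orbit_cvg lt_q xz nopole.
exists z; split.
  apply: mobius_orbit_cvg lt_q _ nopole => //; last exact/eqP.
    by rewrite addrC.
  by rewrite [z * y]mulrC.
(* [z - y] is [((b * z + c) - (b * y + c)) / b], whose numerator is strictly dominated by its first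
   term. *)
rewrite /padic_sphere /= -(absval_subl v_abs lt_q) -vdiv; congr (Cp_absval C _).
by field.
Qed.

End ComplexPadic.

(* In item 2 the starting point is also required to differ from the fixed point
   x_i itself: x_i is not in the pole orbit, its own orbit is constant, and
   x_i does not lie on the sphere S_(alpha_i)(x_i), since alpha_i > beta_i >= 0. *)
Theorem theorem8 (R : realType) (p : nat) (p_prime : prime p)
    (C : complex_padic R p) (a b c s : C)
    (b_neq0 : b <> 0) (c_neq_ab : c <> a * b) (discr_neq0 : discr a b c <> 0)
    (s_sqrt : s ^+ 2 = discr a b c) :
  let f := mobius a b c in
  let x1 := fixpt1 b c s in
  let x2 := fixpt2 b c s in
  let orbit_cvg := fun x l : C =>
    absval_cvg (Cp_absval C) (fun n : nat => iter n f x) l in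
  (forall x : C, ~ (pole_orbit a b c `|` [set x2]) x ->
     (alpha b x1 < beta b c x1 -> orbit_cvg x x1) /\
     (beta b c x1 < alpha b x1 -> x <> x1 ->
        exists l : C, orbit_cvg x l /\ padic_sphere (alpha b x1) x1 l)) /\
  (forall x : C, ~ (pole_orbit a b c `|` [set x1]) x ->
     (alpha b x2 < beta b c x2 -> orbit_cvg x x2) /\
     (beta b c x2 < alpha b x2 -> x <> x2 ->
        exists l : C, orbit_cvg x l /\ padic_sphere (alpha b x2) x2 l)).
Proof.
move=> f x1 x2 orbit_cvg.
have two0 := Cp_two_neq0 C; have b0 := introN eqP b_neq0.
have sum12 : b * (x1 + x2) = 1 - c.
  by rewrite /x1 /x2 /fixpt1 /fixpt2; field; rewrite b0 two0.
have prod12 : b * (x1 * x2) = - a.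
  (* Difference of squares: [s] now occurs only through [s ^+ 2], which [s_sqrt] replaces by the
     discriminant. *)
  have -> : b * (x1 * x2) = ((1 - c) ^+ 2 - s ^+ 2) / (4%:R * b).
    rewrite /x1 /x2 /fixpt1 /fixpt2; field.
    by rewrite b0 two0 (natrM _ 2 2) mulf_neq0.
  by rewrite s_sqrt /discr; field; rewrite b0 (natrM _ 2 2) mulf_neq0.
split=> x nx; first exact: mobius_dynamics b0 sum12 prod12 nx.
(* Exchanging the fixed points preserves their sum and product. *)
by apply: mobius_dynamics nx => //; rewrite 1?addrC 1?[x2 * x1]mulrC.
Qed.
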